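(* Assume that $\mathfrak{p}=\mathfrak{b}=\operatorname{non}(\mathcal{N})$. Then there is a $\mathfrak{p}$-generalized tower $X\subseteq[\mathbb{N}]^{\infty}$ that is not null-additive. In particular, the set $X\cup\mathrm{Fin}\subseteq P(\mathbb{N})$ is a nontrivial set with the property $\gamma$ that is not null-additive.
   Context: $\mathbb{N}=\{1,2,\dots\}$. The power set $P(\mathbb{N})$ is identified, via characteristic functions, with the Cantor cube $\{0,1\}^{\mathbb{N}}$, and carries the corresponding topology and the standard product (fair-coin) measure; ''null'' refers to this measure. $\oplus$ is symmetric difference (coordinatewise addition mod 2). A set $X\subseteq P(\mathbb{N})$ is null-additive if for every null set $Y\subseteq P(\mathbb{N})$ the set $X\oplus Y=\{x\oplus y: x\in X, y\in Y\}$ is null. $\operatorname{non}(\mathcal{N})$ is the minimal cardinality of a subset of $P(\mathbb{N})$ that is not null. $[\mathbb{N}]^{\infty}$ is the family of infinite subsets of $\mathbb{N}$; $\mathrm{Fin}$ is the family of finite subsets of $\mathbb{N}$. Each $a\in[\mathbb{N}]^\infty$ is identified with its increasing enumeration, $a(n)$ being the $n$-th element of $a$. For natural $n<m$, $[n,m)=\{i\in\mathbb{N}: n\le i<m\}$. Write $a\subseteq^* b$ if $a\setminus b$ is finite. A pseudointersection of a family of infinite sets is an infinite set $a$ with $a\subseteq^* b$ for all $b$ in the family. A family of infinite sets is centered if all finite intersections of its elements are infinite. $\mathfrak{p}$ is the minimal cardinality of a subfamily of $[\mathbb{N}]^\infty$ that is centered and has no pseudointersection. For $f,g\in[\mathbb{N}]^\infty$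 write $f\le^* g$ if $\{n: f(n)>g(n)\}$ is finite; a subset of $[\mathbb{N}]^\infty$ is unbounded if for any $g\in[\mathbb{N}]^\infty$ it contains some $f$ with $f\not\le^* g$; $\mathfrak{b}$ is the minimal cardinality of an unbounded subset of $[\mathbb{N}]^\infty$. A set $X\subseteq[\mathbb{N}]^\infty$ with $|X|\ge\mathfrak{p}$ is a $\mathfrak{p}$-generalized tower if for each $a\in[\mathbb{N}]^\infty$ there are $b\in[\mathbb{N}]^\infty$ and $S\subseteq X$ with $|S|<\mathfrak{p}$ such that $x\cap\bigcup_{n\in b}[a(n),a(n+1))\in\mathrm{Fin}$ for all $x\in X\setminus S$. A cover of a space is a family of proper subsets of the space whose union is the whole space; it is open if its members are open. A cover is an $\omega$-cover if each finite subset of the space is contained in a member of the cover, and a $\gamma$-cover if it is infinite and each point of the space belongs to all but finitely many members of the cover. A space has the property $\gamma$ if every open $\omega$-cover of the space contains a $\gamma$-cover. A set with the property $\gamma$ is called nontrivial if its cardinality is at least $\mathfrak{p}$. *)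

(* Defs.v *)
From HB Require Import structures.
From mathcomp Require Import all_boot all_order all_algebra.
From mathcomp Require Import finmap.
From mathcomp Require Import all_classical all_reals all_analysis.

Set Implicit Arguments.
Unset Strict Implicit.
Unset Printing Implicit Defensive.

Import Order.TTheory GRing.Theory Num.Theory.

Local Open Scope classical_set_scope.

(* The positive integers are relabelled 0, 1, 2, ... by i |-> i - 1, both as   *)
(* elements of sets and as indices of enumerations; every notion below is      *)
(* invariant under this relabelling. P(N) is cantor_space = nat -> bool with   *)
(* the product topology.                                                       *)

Definition supp (x : cantor_space) : set nat := [set i | x i].

Definition Fin : set cantor_space := [set x | finite_set (supp x)].

Definition Inf : set cantor_space := [set x | infinite_set (supp x)].

Definition symdiff (x y : cantor_space) : cantor_space := fun i => x i (+) y i.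

Definition is_increasing_enum (a : cantor_space) (e : nat -> nat) : Prop :=
  {homo e : m n / (m < n)%N} /\ range e = supp a.

(* enum_of a n is the (n+1)-st element a(n+1) of a; junk when a is finite. *)
Definition enum_of (a : cantor_space) : nat -> nat :=
  xget (id : nat -> nat) [set e | is_increasing_enum a e].

Lemma enum_ofP a : Inf a -> is_increasing_enum a (enum_of a).
Proof.
move=> infa; apply: (@xgetPex _ (id : nat -> nat)).
have ex k : exists m, (k <= m)%N && a m.
  apply: contrapT => nex; apply: infa; apply: (sub_finite_set _ (finite_II k)).
  move=> i /= ai; rewrite ltnNge; apply/negP => ki.
  by apply: nex; exists i; rewrite ki.
pose nx k := ex_minn (ex k).
have nxP k : [/\ (k <= nx k)%N, a (nx k) &
    forall m, (k <= m)%N -> a m -> (nx k <= m)%N].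
  rewrite /nx; case: ex_minnP => m /andP[km am] least; split=> // m' km' am'.
  by apply: least; rewrite km'.
pose e := fix e n := if n is n'.+1 then nx (e n').+1 else nx 0%N.
have e_lt n : (e n < e n.+1)%N by have [] := nxP (e n).+1.
have e_mono : {homo e : m n / (m < n)%N} by apply: homo_ltn => //; exact: ltn_trans.
have e_ge n : (n <= e n)%N by elim: n => // n IHn; exact: leq_ltn_trans IHn (e_lt n).
exists e; split => //; apply/seteqP; split=> [_ [[|n] _ <-]|i ai].
- by have [] := nxP 0%N.
- by have [] := nxP (e n).+1.
- have : exists n, (i <= e n)%N by exists i.
  case/ex_minnP => -[|n] ien least; [exists 0%N | exists n.+1] => //.
    by apply/eqP; rewrite eqn_leq ien andbT; have [_ _] := nxP 0%N; apply.
  apply/eqP; rewrite eqn_leq ien andbT; have [_ _] := nxP (e n).+1; apply=> //.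
  by rewrite ltnNge; apply/negP => /least; rewrite ltnn.
Qed.

Definition almost_sub (a b : cantor_space) : Prop :=
  finite_set (supp a `\` supp b).

Definition pseudointersection (F : set cantor_space) (a : cantor_space) : Prop :=
  Inf a /\ forall b, F b -> almost_sub a b.

Definition centered (F : set cantor_space) : Prop :=
  forall D : set cantor_space, finite_set D -> D `<=` F ->
    infinite_set (\bigcap_(x in D) supp x).

Definition le_star (f g : cantor_space) : Prop :=
  finite_set [set n | (enum_of g n < enum_of f n)%N].

Definition unbounded (B : set cantor_space) : Prop :=
  forall g, Inf g -> exists2 f, B f & ~ le_star f g.

(* A cardinal is represented by a set of that cardinality. min_card Phi is a   *)
(* member of Phi of least cardinality; it exists by min_cardP.                 *)
Definition min_card (T : Type) (Phi : set (set T)) : set T :=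
  xget set0 [set A | Phi A /\ forall B, Phi B -> (A #<= B)%card].

Lemma min_cardP T (Phi : set (set T)) : Phi !=set0 ->
  Phi (min_card Phi) /\ forall B, Phi B -> (min_card Phi #<= B)%card.
Proof.
move=> [A0 PA0].
suff : exists A, Phi A /\ forall B, Phi B -> (A #<= B)%card.
  exact: (@xgetPex _ set0).
have [P0|nP0] := pselect (Phi set0).
  by exists set0; split=> // B _; exact: card_le_emptyl.
have nonempty A : Phi A -> exists x, A x.
  by move=> PA; apply/set0P/eqP => A0E; apply: nP0; rewrite -A0E.
have [t0 _] := nonempty _ PA0.
pose good (Y : set (set T -> T)) :=
  (forall f, Y f -> forall A, Phi A -> A (f A)) /\
  (forall f g, Y f -> Y g -> forall A, Phi A -> f A = g A -> f = g).
have [|Y [[Ysel Yinj] Ymax]] := @Zorn_bigcup _ good.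
  move=> F Fgood Ftot; split=> [f [Z FZ Zf]|f g [Z FZ Zf] [W FW Wg]].
    exact: ((Fgood _ FZ).1 _ Zf).
  have [ZW|WZ] := Ftot _ _ FZ FW.
    exact: (Fgood _ FW).2 (ZW _ Zf) Wg.
  exact: (Fgood _ FZ).2 Zf (WZ _ Wg).
have [[A [PA Asurj]]|nsurj] := pselect (exists A, Phi A /\
    forall a, A a -> exists f, Y f /\ f A = a).
  exists A; split=> // B PB.
  have [h hP] : {h & forall a, A a -> Y (h a) /\ h a A = a}.
    apply: (@choice _ _ (fun a f => A a -> Y f /\ f A = a)) => a.
    have [Aa|nAa] := pselect (A a); last by exists (fun=> t0).
    by have [f Yf] := Asurj _ Aa; exists f.
  suff /injfunPex[g] : exists2 f : T -> T, set_fun A B f & set_inj A f.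
    exact: inj_card_le g.
  exists (fun a => h a B); first by move=> a /hP[Yh _]; exact: (Ysel _ Yh).
  move=> a b /set_mem /hP[Ya ha] /set_mem /hP[Yb hb] hab.
  by rewrite -ha -hb (Yinj _ _ Ya Yb _ PB hab).
have [c cP] : {c & forall A, Phi A -> A (c A) /\ forall f, Y f -> f A <> c A}.
  apply: (@choice _ _ (fun A a => Phi A -> A a /\ forall f, Y f -> f A <> a)) => A.
  have [PA|nPA] := pselect (Phi A); last by exists t0.
  apply: contrapT => nex; apply: nsurj; exists A; split=> // a Aa.
  apply: contrapT => nf; apply: nex; exists a; split=> // f Yf fa.
  by apply: nf; exists f.
exfalso; apply: (Ymax (Y `|` [set c])).
  split=> [f Yf|/(_ c (or_intror erefl)) Yc]; first by left.
  exact: (cP _ PA0).2 Yc erefl.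
split=> [f [Yf|->] A PA|f g [Yf|->] [Yg|->] A PA fg].
- exact: (Ysel _ Yf).
- exact: (cP _ PA).1.
- exact: Yinj fg.
- by case: ((cP _ PA).2 _ Yf).
- by case: ((cP _ PA).2 _ Yg).
- by [].
Qed.

Definition card_lt (T U : Type) (A : set T) (B : set U) : Prop :=
  (A #<= B)%card /\ ~ (B #<= A)%card.

Definition cardinal_p : set cantor_space :=
  min_card [set F | F `<=` Inf /\ centered F /\
                    ~ exists a, pseudointersection F a].

Definition cardinal_b : set cantor_space :=
  min_card [set B | B `<=` Inf /\ unbounded B].

Definition blocks (a b : cantor_space) : set nat :=
  \bigcup_(n in supp b) [set i | (enum_of a n <= i < enum_of a n.+1)%N].

Definition p_generalized_tower (X : set cantor_space) : Prop :=
  [/\ X `<=` Inf, (cardinal_p #<= X)%card &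
      forall a, Inf a ->
        exists b, exists S : set cantor_space,
          [/\ Inf b, S `<=` X, card_lt S cardinal_p &
              forall x, (X `\` S) x -> finite_set (supp x `&` blocks a b)]].

Section covers.
Variable T : topologicalType.
Implicit Types U V : set (set T).

Definition is_cover U : Prop :=
  (forall u, U u -> u <> setT) /\ \bigcup_(u in U) u = setT.

Definition open_family U : Prop := forall u, U u -> open u.

Definition omega_cover U : Prop :=
  is_cover U /\
  forall D : set T, finite_set D -> exists2 u, U u & D `<=` u.

Definition gamma_cover U : Prop :=
  [/\ is_cover U, infinite_set U &
      forall x, finite_set [set u | U u /\ ~ u x]].

End covers.

Definition property_gamma (T : topologicalType) : Prop :=
  forall U : set (set T), open_family U -> omega_cover U ->
    exists2 V, V `<=` U & gamma_cover V.

(* The set X as a space in its own right: set_type X is the subtype of points  *)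
(* of X, with the topology induced by the inclusion.                           *)
Definition set_property_gamma (X : set cantor_space) : Prop :=
  property_gamma (set_type X).

Definition nontrivial_gamma (X : set cantor_space) : Prop :=
  set_property_gamma X /\ (cardinal_p #<= X)%card.

Local Open Scope ring_scope.

(* Fair-coin measure: the Caratheodory extension of the content giving an      *)
(* event that depends only on the first n coordinates the proportion of binary *)
(* strings of length n that satisfy it (padding a string with false does not   *)
(* affect such an event).                                                      *)

Definition depends_on (n : nat) (A : set cantor_space) : Prop :=
  forall x y : cantor_space, (forall i, (i < n)%N -> x i = y i) -> A x -> A y.

Definition finite_event : set (set cantor_space) :=
  [set A | exists n, depends_on n A].

Definition pad n (t : n.-tuple bool) : cantor_space := fun i => nth false t i.

Definition proportion (R : realType) (n : nat) (A : set cantor_space) : R :=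
  #|[set t : n.-tuple bool | `[< A (pad t) >]]%SET|%:R / 2 ^+ n.

(* cantor_space with the algebra of finite-dimensional events; the sigma-      *)
(* algebra it generates is the Borel one.                                      *)
Definition coin_space : Type := cantor_space.

HB.instance Definition _ := Pointed.on coin_space.

Lemma finite_event0 : finite_event set0.
Proof. by exists 0%N. Qed.

Lemma depends_onW m n A : (m <= n)%N -> depends_on m A -> depends_on n A.
Proof.
by move=> mn mA x y xy; apply: mA => i im; apply: xy; exact: leq_trans mn.
Qed.

Lemma finite_eventU : setU_closed finite_event.
Proof.
move=> A B [m mA] [n nB]; exists (maxn m n) => x y xy [Ax|Bx]; [left|right].
  exact: (depends_onW (leq_maxl m n) mA xy Ax).
exact: (depends_onW (leq_maxr m n) nB xy Bx).
Qed.

Lemma depends_onC n A : depends_on n A -> depends_on n (~` A).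
Proof.
by move=> nA x y xy; apply: contra_not; apply: nA => i /xy.
Qed.

Lemma finite_eventC : setC_closed finite_event.
Proof. by move=> A [n /depends_onC nA]; exists n. Qed.

Definition coin_display : measure_display. Proof. exact. Qed.

HB.instance Definition _ := isAlgebraOfSets.Build coin_display coin_space
  finite_event0 finite_eventU finite_eventC.

Lemma proportionD R n k A : depends_on n A ->
  proportion R (n + k) A = proportion R n A.
Proof.
move=> nA; rewrite /proportion.
pose c (p : n.-tuple bool * k.-tuple bool) := cat_tuple p.1 p.2.
have c_inj : injective c.
  move=> [u v] [u' v'] /(congr1 val) /= /eqP.
  rewrite eqseq_cat ?size_tuple// => /andP[/eqP uu' /eqP vv'].
  by congr pair; apply: val_inj.
have [d cK dK] : bijective c.
  by apply: inj_card_bij => //; rewrite card_prod !card_tuple expnD.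
have -> : [set t : (n + k).-tuple bool | `[< A (pad t) >]]%SET =
   (c @: finset.setX [set t : n.-tuple bool | `[< A (pad t) >]]%SET [set: k.-tuple bool]%SET)%SET.
  have H u v : A (pad (c (u, v))) <-> A (pad u).
    by split; apply: nA => i ni; rewrite /pad/= nth_cat size_tuple ni.
  apply/setP => t; apply/idP/imsetP => [|[[u v]]].
    rewrite inE => At; exists (d t); rewrite ?dK// !inE andbT.
    case: (d t) (dK t) At => u v <- /asboolP cA; apply/asboolP.
    exact: (H u v).1 cA.
  rewrite finset.in_setX inE => /andP[/asboolP Au _] ->.
  by rewrite inE; apply/asboolP; exact: (H u v).2 Au.
rewrite card_imset// cardsX cardsT card_tuple card_bool natrM natrX exprD.
by rewrite -mulf_div divff ?mulr1// expf_neq0// pnatr_eq0.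
Qed.

Definition coin_content (R : realType) (A : set coin_space) : \bar R :=
  (proportion R (xget 0%N [set n | depends_on n A]) A)%:E.

Lemma coin_contentE R n A : depends_on n A ->
  coin_content R A = (proportion R n A)%:E.
Proof.
move=> nA; rewrite /coin_content; congr EFin.
have : depends_on (xget 0%N [set n | depends_on n A]) A.
  by apply: (@xgetPex _ 0%N [set n | depends_on n A]); exists n.
move: (xget _ _) => m mA.
by rewrite -(proportionD R n mA) -(proportionD R m nA) addnC.
Qed.

Lemma depends_on_open n A : depends_on n A -> open A.
Proof.
move=> nA; rewrite openE => x Ax; rewrite /interior.
have nx : nbhs x [set y : cantor_space | forall i, (i < n)%N -> y i = x i].
  elim: {nA} n => [|n IHn]; first by apply: filterS filterT.
  have xn : nbhs x [set y : cantor_space | y n = x n].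
    exact: (@proj_continuous nat (fun=> bool) n x _ (discrete_set1 (x n))).
  apply: filterS2 IHn xn => y yx yn i; rewrite ltnS leq_eqVlt.
  by case/orP=> [/eqP ->|/yx].
by apply: filterS nx => y yx; apply: nA Ax => i /yx.
Qed.

Section coin_measure.
Variable R : realType.

Let content : set coin_space -> \bar R := coin_content R.

Let content_ge0 A : (0 <= content A)%E.
Proof. by rewrite lee_fin divr_ge0// exprn_ge0. Qed.

Let content_additive : measure_function.semi_additive content.
Proof.
apply/additive2P => [|A B [m mA] [n nB] AB0].
  rewrite /content (@coin_contentE R 0%N) // /proportion.
  rewrite (_ : [set t | _]%SET = finset.set0) ?cards0 ?mul0r//.
  by apply/setP => t; rewrite !inE; apply/asboolF.
have [pA pB] : depends_on (maxn m n) A /\ depends_on (maxn m n) B.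
  split; [exact: depends_onW (leq_maxl _ _) mA|].
  exact: depends_onW (leq_maxr _ _) nB.
have pAB : depends_on (maxn m n) (A `|` B).
  by move=> x y xy [Ax|Bx]; [left; exact: pA xy Ax|right; exact: pB xy Bx].
rewrite /content (coin_contentE R pA) (coin_contentE R pB).
rewrite (coin_contentE R pAB).
rewrite -EFinD /proportion -mulrDl -natrD; congr (_%:R / _)%:E.
rewrite -cardsUI [X in (_ + X)%N](_ : _ = 0%N) ?addn0.
  apply: eq_card => t; rewrite !inE; apply/asboolP/orP.
    by move=> [?|?]; [left|right]; apply/asboolP.
  by move=> [/asboolP ?|/asboolP ?]; [left|right].
apply/eqP; rewrite cards_eq0; apply/eqP/setP => t; rewrite !inE.
apply/negbTE/negP => /andP[/asboolP At /asboolP Bt].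
by have : (A `&` B) (pad t) by []; rewrite AB0.
Qed.

HB.instance Definition _ := isContent.Build _ coin_space R (coin_content R)
  content_ge0 content_additive.

Let content_sigma_subadditive :
  measurable_subset_sigma_subadditive (coin_content R).
Proof.
move=> A F mF mA; rewrite /subset_sigma_subadditive => AF.
have cA : compact (A : set cantor_space).
  apply: (subclosed_compact _ cantor_space_compact) => //.
  by rewrite -openC; case: mA => n /depends_onC /depends_on_open.
have [n nA] := mA.
move: cA; rewrite compact_cover => /(_ nat setT F).
have oF i : setT i -> open (F i : set cantor_space).
  by move=> _; have [k /depends_on_open] := mF i.
move=> /(_ oF AF)[D _ AD].
rewrite nneseries_esum; last by move=> k _; exact: content_ge0.
apply: esum_ge; exists [set` D] => //.
have := @content_sub_fsum _ R coin_space
  (coin_content R : {content set coin_space -> \bar R}) nat [set` D] A F.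
by apply.
Qed.

HB.instance Definition _ := Content_SigmaSubAdditive_isMeasure.Build _ _ _
  (coin_content R) content_sigma_subadditive.

End coin_measure.

Definition coin_measure (R : realType) :=
  measure_extension (coin_content R : {measure set coin_space -> \bar R}).

HB.instance Definition _ (R : realType) := Measure.on (coin_measure R).

Lemma coin_measureE (R : realType) n A : depends_on n A ->
  coin_measure R A = (proportion R n A)%:E.
Proof.
move=> nA; rewrite -(coin_contentE R nA) /coin_measure /measure_extension.
by rewrite measurable_mu_extE//; exists n.
Qed.

Lemma coin_measure_cylinder (R : realType) n (x : cantor_space) :
  coin_measure R [set y | forall i, (i < n)%N -> y i = x i] = (2 ^- n)%:E.
Proof.
rewrite (@coin_measureE R n) => [|y z yz yx i ni]; last by rewrite -yz// yx.
rewrite /proportion (_ : [set t | _]%SET = finset.set1 [tuple x i | i < n]).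
  by rewrite cards1 mul1r.
apply/setP => t; rewrite !inE; apply/asboolP/eqP => [tx|-> i ni].
  apply: eq_from_tnth => i; rewrite tnth_mktuple -(tx i)//.
  by rewrite /pad (tnth_nth false).
rewrite /pad; have := tnth_nth false [tuple x i | i < n] (Ordinal ni).
by rewrite tnth_mktuple => /= <-.
Qed.

Definition null (R : realType) (Y : set cantor_space) : Prop :=
  (coin_measure R).-negligible Y.

Definition null_additive (R : realType) (X : set cantor_space) : Prop :=
  forall Y, null R Y -> null R [set symdiff x y | x in X & y in Y].

Definition cardinal_nonN (R : realType) : set cantor_space :=
  min_card [set A | ~ null R A].

(* Main.v *)
(* Under p = b there is a tower (w_i) of order type b, decreasing modulo finite
   sets, that is unbounded. Spread w_i over the dyadic blocks [2^n, 2^(n+1)) and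
   fill the blocks selected by w_i with a copy of y_i, where (y_i) enumerates a
   set that is not null; this gives the points x_i of X. On infinitely many
   blocks x_i + y_i vanishes off the first point of the block, which is a null
   condition, so X plus a null set contains all y_i and X is not null-additive.

   Unboundedness makes the blocks of some w_i miss infinitely many of any given
   sequence of intervals, and x_j for j >= i is almost contained in the blocks
   of w_i: X is a generalized tower. For the property gamma, iterate the
   Galvin-Miller argument: a_k increases in the index order, a subsequence of
   the omega-cover is a gamma-cover of Fin and of all x_j with j < a_k, and its
   gaps are missed infinitely often by the blocks of w_(a_(k+1)). At s = sup a_k
   one gap is chosen for each k, missed by the blocks of w_s, which handles all
   x_j with j >= s, and far enough to handle the fewer than b points x_j with
   j < s. *)
Require Import Defs.
From mathcomp Require Import all_boot all_order all_algebra.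
From mathcomp Require Import finmap.
From mathcomp Require Import all_classical all_reals all_analysis.
From mathcomp Require wochoice.

Set Implicit Arguments.
Unset Strict Implicit.
Unset Printing Implicit Defensive.

Import Order.TTheory GRing.Theory Num.Theory.

Local Open Scope classical_set_scope.

(** * Subsets of the natural numbers and their enumerations *)

Lemma finite_natP (A : set nat) :
  finite_set A <-> \forall n \near \oo, ~ A n.
Proof.
split=> [/finite_seqP[s As]|[N _ NA]]; last first.
  apply: (sub_finite_set _ (finite_II N)) => n An /=.
  by rewrite ltnNge; apply/negP => /NA.
exists (\max_(i <- s) i).+1 => // n /= lt_n; rewrite As /= => sn.
by move: lt_n; rewrite ltnNge (leq_bigmax_seq (F := id) n).
Qed.

Lemma infinite_natP (A : set nat) :
  infinite_set A <-> forall N, exists2 n, (N <= n)%N & A n.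
Proof.
split=> [infA N|infA /finite_natP[N _ NA]]; last first.
  by have [n /NA] := infA N.
apply: contrapT => nex; apply/infA/finite_natP; exists N => // n Nn An.
by apply: nex; exists n.
Qed.

Lemma near_infinite (A B : set nat) :
  infinite_set A -> (\forall n \near \oo, B n) -> infinite_set (A `&` B).
Proof.
move=> /infinite_natP infA [M _ MB]; apply/infinite_natP => N.
have [n] := infA (maxn N M); rewrite geq_max => /andP[Nn Mn] An.
by exists n => //; split=> //; exact: MB.
Qed.

Lemma almost_subP a b :
  almost_sub a b <-> \forall i \near \oo, a i -> b i.
Proof.
rewrite /almost_sub finite_natP; split; apply: filterS => i /=.
  by move=> nab ai; apply: contrapT => /negP nbi; apply: nab; split=> //; exact/negP.
by move=> ab [/ab].
Qed.

Lemma almost_sub_refl a : almost_sub a a.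
Proof. by apply/almost_subP; apply: nearW. Qed.

Lemma almost_sub_trans a b c :
  almost_sub a b -> almost_sub b c -> almost_sub a c.
Proof.
move=> /almost_subP ab /almost_subP bc; apply/almost_subP.
by apply: filterS2 ab bc => i ab bc /ab.
Qed.

Lemma homo_ltn_geq_id (h : nat -> nat) :
  {homo h : m n / (m < n)%N} -> forall n, (n <= h n)%N.
Proof. by move=> hh; elim=> // n IHn; exact: leq_ltn_trans IHn (hh _ _ _). Qed.

(** Write [e'] as [e] composed with [k]; then [k] is strictly increasing, so [n <= k n]. *)
Lemma increasing_enum_le (e e' : nat -> nat) :
  {homo e : m n / (m < n)%N} -> {homo e' : m n / (m < n)%N} ->
  range e' `<=` range e -> forall n, (e n <= e' n)%N.
Proof.
move=> e_mono e'_mono sub n.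
have /choice[k kP] : forall m, exists k, e k = e' m.
  by move=> m; have [|k _ ek] := sub (e' m); [exists m|exists k].
have e_le : {mono e : i j / (i <= j)%N} by exact: leq_mono.
have k_mono : {homo k : i j / (i < j)%N}.
  by move=> i j /e'_mono; rewrite -!kP !ltnNge e_le.
by rewrite -kP e_le homo_ltn_geq_id.
Qed.

Definition range_set (h : nat -> nat) : cantor_space := fun i => `[< range h i >].

Lemma supp_range_set h : supp (range_set h) = range h.
Proof. by apply/seteqP; split=> i /asboolP. Qed.

Lemma Inf_range_set h : {homo h : m n / (m < n)%N} -> Inf (range_set h).
Proof.
move=> hh; rewrite /Inf /= supp_range_set; apply/infinite_natP => N.
by exists (h N); [exact: homo_ltn_geq_id|exists N].
Qed.

Lemma enum_of_range_set h :
  {homo h : m n / (m < n)%N} -> enum_of (range_set h) = h.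
Proof.
move=> hh; have [eh er] := enum_ofP (Inf_range_set hh).
rewrite supp_range_set in er.
by apply/funext => n; apply/eqP; rewrite eqn_leq !increasing_enum_le// er.
Qed.

Lemma enum_of_homo a : Inf a -> {homo enum_of a : m n / (m < n)%N}.
Proof. by case/enum_ofP. Qed.

Lemma enum_of_in a n : Inf a -> a (enum_of a n).
Proof. by move=> /enum_ofP[_ re]; have : supp a (enum_of a n) by rewrite -re. Qed.

Definition majorant (f : nat -> nat) n := (\sum_(i < n.+1) (f i).+1)%N.

Lemma majorant_homo f : {homo majorant f : m n / (m < n)%N}.
Proof.
apply: homo_ltn => [|n]; first exact: ltn_trans.
by rewrite /majorant [ltnRHS]big_ord_recr /= -addn1 leq_add2l.
Qed.

Lemma majorant_ge f n : (f n < majorant f n)%N.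
Proof. by rewrite /majorant big_ord_recr /= leq_addl. Qed.

Lemma seq_dominated (g : nat -> nat -> nat) :
  exists h, forall k, \forall n \near \oo, (g k n <= h n)%N.
Proof.
exists (fun n => \max_(k < n.+1) g k n) => k; exists k => // n /= kn.
by rewrite -ltnS in kn; exact: (leq_bigmax (Ordinal kn)).
Qed.

Lemma le_starP f g :
  le_star f g <-> \forall n \near \oo, (enum_of f n <= enum_of g n)%N.
Proof.
rewrite /le_star finite_natP; split; apply: filterS => n /= gf.
  by rewrite leqNgt; apply/negP.
by apply/negP; rewrite -leqNgt.
Qed.

(** * Sets of fewer than b elements *)

Lemma cardinal_bP : [/\ cardinal_b `<=` Inf, unbounded cardinal_b &
  forall B, B `<=` Inf -> unbounded B -> (cardinal_b #<= B)%card].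
Proof.
have [|[bInf ub] least] :=
  @min_cardP cantor_space [set B | B `<=` Inf /\ unbounded B].
  (* The successors of the values of [enum_of g] enumerate an infinite set that exceeds [g]
     everywhere. *)
  exists Inf; split=> // g Inf_g; pose h n := (enum_of g n).+1.
  have hh : {homo h : m n / (m < n)%N} by move=> m n /(enum_of_homo Inf_g).
  exists (range_set h); first exact: Inf_range_set.
  move=> /le_starP[N _ /(_ N (leqnn N))] /=.
  by rewrite enum_of_range_set// ltnn.
by split=> // B BInf Bub; exact: least.
Qed.

Lemma cardinal_b_unbounded (g : nat -> nat) :
  exists2 f, cardinal_b f & infinite_set [set n | (g n < enum_of f n)%N].
Proof.
have [_ /(_ (range_set (majorant g))) ub _] := cardinal_bP.
have [|f bf nle] := ub; first exact/Inf_range_set/majorant_homo.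
exists f => // fin; apply: nle; apply: sub_finite_set fin => n /=.
rewrite enum_of_range_set; last exact: majorant_homo.
exact/ltn_trans/majorant_ge.
Qed.

Definition small (T : Type) (S : set T) : Prop := ~ (cardinal_b #<= S)%card.

Lemma small_le T U (A : set T) (B : set U) :
  (A #<= B)%card -> small B -> small A.
Proof. by move=> AB; apply: contra_not => bA; exact: card_le_trans AB. Qed.

(** The majorants of the [phi x] enumerate fewer than b infinite sets, and these cannot form an
    unbounded family. *)
Lemma small_dominated T (S : set T) (phi : T -> nat -> nat) : small S ->
  exists g, forall x, S x -> \forall n \near \oo, (phi x n <= g n)%N.
Proof.
move=> smS; pose r x := range_set (majorant (phi x)).
have [_ _ least] := cardinal_bP.
have nub : ~ unbounded (r @` S).
  move=> ub; apply: smS; apply: card_le_trans (card_image_le r S).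
  by apply: least ub => _ [x _ <-]; exact/Inf_range_set/majorant_homo.
have [g Sg] : exists g, forall f, (r @` S) f -> le_star f g.
  apply: contrapT => nex; apply: nub => g _; apply: contrapT => nf; apply: nex.
  by exists g => f Sf; apply: contrapT => nle; apply: nf; exists f.
exists (enum_of g) => x Sx; have /le_starP := Sg _ (imageP r Sx).
rewrite enum_of_range_set; last exact: majorant_homo.
by apply: filterS => n; apply: leq_trans; exact/ltnW/majorant_ge.
Qed.

(** The cofinality of b is uncountable: if the union mapped onto [cardinal_b], the image of each
    [S n] would have a bound, and one function would dominate these countably many bounds. *)
Lemma small_bigcup T (S : nat -> set T) :
  (forall n, small (S n)) -> small (\bigcup_n S n).
Proof.
move=> smS /pcard_surjP[q qsurj].
have /choice[g gP] : forall n, exists g, forall x, S n x ->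
    \forall i \near \oo, (enum_of (q x) i <= g i)%N.
  by move=> n; exact: small_dominated.
have [h hP] := seq_dominated g.
have [f bf] := cardinal_b_unbounded h; have [x [n _ Snx] <-] := qsurj _ bf.
apply; apply/finite_natP; apply: filterS2 (gP n x Snx) (hP n) => i le1 le2.
by apply/negP; rewrite -leqNgt; exact: leq_trans le2.
Qed.

Lemma countable_small T (S : set T) : countable S -> small S.
Proof.
move=> cS; apply: small_le cS _ => /pcard_surjP[q qsurj].
have [h hP] := seq_dominated (enum_of \o q).
have [f bf] := cardinal_b_unbounded h; have [n _ <-] := qsurj _ bf.
apply; apply/finite_natP; apply: filterS (hP n) => i le.
by apply/negP; rewrite -leqNgt.
Qed.

Lemma small_setU T (A B : set T) : small A -> small B -> small (A `|` B).
Proof.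
move=> smA smB; apply: (@small_le _ _ _ (\bigcup_n if n is 0 then A else B)).
  by apply: subset_card_le => x [?|?]; [exists 0%N|exists 1%N].
by apply: small_bigcup => -[].
Qed.

Lemma small_pseudointersection (T : Type) (S : set T) (A : T -> cantor_space) :
  (cardinal_p #= cardinal_b)%card -> small S ->
  (forall D, finite_set D -> D `<=` S ->
    infinite_set [set n | forall x, D x -> A x n]) ->
  exists2 a, Inf a & forall x, S x -> almost_sub a (A x).
Proof.
move=> pb smS cent.
have [F0 PF0] : [set F | F `<=` Inf /\ centered F /\
    ~ exists a, pseudointersection F a] !=set0.
  apply: contrapT => nF.
  (* [min_card] defaults to the empty set when no family qualifies; by p = b, [cardinal_b] would
     then be empty too. *)
  have p0 : cardinal_p = set0.
    by apply: xgetPN => B [PB _]; apply: nF; exists B.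
  have [f bf _] := cardinal_b_unbounded id.
  by move: pb; rewrite p0 card_eq_sym card_eq0 => /eqP b0; rewrite b0 in bf.
have [_ least] := min_cardP (ex_intro _ _ PF0).
have [a [Infa aP]] : exists a, pseudointersection (A @` S) a.
  apply: contrapT => nps; apply: smS; rewrite -(card_le_eql pb).
  apply: card_le_trans (card_image_le A S); apply: least; split.
    move=> _ [x Sx <-]; apply: sub_infinite_set (cent [set x] _ _) => //.
    - by move=> n /=; exact.
    - by move=> _ ->.
  split=> // D finD DS.
  (* The finite set [D] of images is pulled back to a finite subset of [S]. *)
  have /choice[c cP] : forall z, exists Z : set T, [/\ finite_set Z, Z `<=` S &
      D z -> exists2 x, Z x & A x = z].
    move=> z; have [/DS[x Sx Axz]|nDz] := pselect (D z).
      by exists [set x]; split=> [|_ -> //|_]; [exact: finite_set1|exists x].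
    by exists set0; split=> //; exact: finite_set0.
  apply: sub_infinite_set (cent (\bigcup_(z in D) c z) _ _).
  - move=> n /= nP z Dz; have [_ _ /(_ Dz)[x cx <-]] := cP z.
    by apply: nP; exists z.
  - by apply: bigcup_finite => // z _; have [] := cP z.
  - by move=> x [z _]; have [_ + _] := cP z; apply.
exists a => // x Sx; apply: aP; exact: imageP.
Qed.

(** * Unbounded towers *)

(** If some segment of a well-order is as large as [T], take the least such endpoint [b], inject [T]
    below [b] by [h] and pull the order back. The new segment of [x] embeds below [h x], hence is
    smaller than [T] by minimality of [b]. *)
Lemma well_order_card_lt (T : eqType) : exists lt : rel T,
  [/\ well_founded (fun x y => lt x y), transitive lt,
      forall x y, [|| lt x y, x == y | lt y x] &
      forall x, ~ ([set: T] #<= [set y | lt y x])%card].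
Proof.
suff [R [wfR trR totR segR]] : exists R : T -> T -> Prop,
    [/\ well_founded R, (forall x y z, R x y -> R y z -> R x z),
        (forall x y, [\/ R x y, x = y | R y x]) &
        forall x, ~ ([set: T] #<= [set y | R y x])%card].
  exists (fun x y => `[< R x y >]); split.
  - move=> x; elim: (wfR x) => {}x _ IHx.
    by constructor=> y /asboolP /IHx.
  - by move=> y x z /asboolP xy /asboolP yz; apply/asboolP; exact: trR yz.
  - by move=> x y; apply/or3P; case: (totR x y) => [?|->|?];
      [constructor 1; exact/asboolP|constructor 2|constructor 3; exact/asboolP].
  - move=> x; rewrite (_ : [set y | _] = [set y | R y x]); first exact: segR.
    by apply/seteqP; split=> y /asboolP.
have [r wor] := wochoice.well_ordering_principle T.
have minr (A : set T) : A !=set0 -> exists2 x, A x & forall y, A y -> r x y.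
  move=> [x0 Ax0]; have [|x [[/asboolP Ax xP] _]] := wor (fun x => `[< A x >]).
    by exists x0; exact/asboolP.
  by exists x => // y Ay; apply: xP; exact/asboolP.
have totr x y : r x y || r y x.
  have [|z [->|->] zP] := minr [set x; y]; first by exists x; left.
    by rewrite zP//; right.
  by rewrite orbC zP//; left.
(* Antisymmetry comes from the uniqueness of the minimum of a pair. *)
have antir x y : r x y -> r y x -> x = y.
  move=> xy yx; have [|z [_ Uz]] := wor (fun z => (z == x) || (z == y)).
    by exists x; apply/orP; left.
  have rr z' : r z' z' by have := totr z' z'; rewrite orbb.
  rewrite -(Uz x); last by split=> [|_ /orP[] /eqP->//]; apply/orP; left.
  by rewrite -(Uz y)//; split=> [|_ /orP[] /eqP->//]; apply/orP; right.
have trr x y z : r x y -> r y z -> r x z.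
  move=> xy yz; have [|m] := minr [set x; y; z]; first by exists x; left; left.
  move=> [[->|->]|->] mP.
  - by apply: mP; right.
  - by rewrite (antir _ _ xy (mP x _))//; left; left.
  - by rewrite -(antir _ _ yz (mP y _))//; left; right.
pose lt x y := ~~ r y x.
have lt_tr x y z : lt x y -> lt y z -> lt x z.
  rewrite /lt => xy yz; apply: contra xy => zx.
  by have := totr y z; rewrite (negbTE yz) orbF => /trr; apply.
have wf_lt : well_founded (fun x y => lt x y).
  move=> x0; apply: contrapT => nacc.
  have [|x nx xP] := minr [set x | ~ Acc (fun x y => lt x y) x]; first by exists x0.
  apply: nx; constructor=> y yx; apply: contrapT => ny.
  by move/negP: yx; apply; exact: xP.
have lt_tot x y : [\/ lt x y, x = y | lt y x].
  have [yx|] := boolP (r y x); last by constructor 1.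
  have [xy|] := boolP (r x y); last by constructor 3.
  by constructor 2; exact: antir.
have [[b bP]|nbad] := pselect (exists x, ([set: T] #<= [set y | lt y x])%card);
    last first.
  exists (fun x y => lt x y); split=> // x Tx; by apply: nbad; exists x.
have [|{bP}b bP bmin] := minr [set x | ([set: T] #<= [set y | lt y x])%card].
  by exists b.
have [h hlt hinj] : exists2 h : T -> T, (forall x, lt (h x) b) & injective h.
  have /card_leP[f] := bP.
  pose i x : [set: T] := SigSub (mem_set (I : [set: T] x)).
  exists (fun x => \val (f (i x))) => [x|x y /val_inj fxy].
    by have /set_mem := valP (f (i x)).
  have /(congr1 val) : i x = i y by apply: (@inj _ _ _ f) fxy; rewrite inE.
  by [].
exists (fun x y => lt (h x) (h y)); split.
- move=> x; have [m mh] : exists m, h x = m by exists (h x).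
  elim: (wf_lt m) x mh => {}m _ IHm x hx.
  by constructor=> y; rewrite hx => yx; exact: IHm yx _ erefl.
- by move=> x y z; exact: lt_tr.
- move=> x y; case: (lt_tot (h x) (h y)) => [?|/hinj ?|?].
  + by constructor 1.
  + by constructor 2.
  + by constructor 3.
- move=> x Tx; have /negP := hlt x; apply.
  apply: bmin => /=; apply: card_le_trans Tx _.
  pose L := [set y | lt (h y) (h x)].
  have /card_eqPle[_ Lh] : (h @` L #= L)%card.
    by apply: inj_card_eq => ? ? _ _; exact: hinj.
  by apply: card_le_trans Lh _; apply: subset_card_le => _ [y ? <-].
Qed.

Record unbounded_tower (I : eqType) (lt : rel I) (w : I -> cantor_space) : Prop :=
  UnboundedTower {
    tower_wf : well_founded (fun i j => lt i j);
    tower_trans : transitive lt;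
    tower_total : forall i j, [|| lt i j, i == j | lt j i];
    tower_small : forall i, small [set j | lt j i];
    tower_Inf : forall i, Inf (w i);
    tower_decr : forall i j, lt i j -> almost_sub (w j) (w i);
    tower_unbounded : forall g, exists i,
      infinite_set [set n | (g n < enum_of (w i) n)%N] }.

Arguments tower_small {I lt w} _ i _.
Arguments tower_Inf {I lt w} _ i _.

(** Recursion along a well-order of an unbounded family of size b: [w i] is a pseudointersection of
    its predecessors, thinned until its enumeration dominates the member [i] of the family. *)
Lemma exists_unbounded_tower : (cardinal_p #= cardinal_b)%card ->
  exists (lt : rel cardinal_b) (w : cardinal_b -> cantor_space),
    unbounded_tower lt w.
Proof.
move=> pb; have [lt [wf_lt tr_lt tot_lt seg_lt]] := well_order_card_lt cardinal_b.
have smseg i : small [set j | lt j i].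
  by rewrite /small -(card_le_eql (card_setT _)); exact: seg_lt.
pose f (i : cardinal_b) := enum_of (\val i).
have Infi (i : cardinal_b) : Inf (\val i).
  by have [bI _ _] := cardinal_bP; apply: bI; exact: set_mem (valP i).
pose good (F : set cantor_space) (h : nat -> nat) (a : cantor_space) :=
  [/\ Inf a, forall n, (h n <= enum_of a n)%N & forall b, F b -> almost_sub a b].
(* The value is junk when nothing qualifies; [wP] excludes this by induction. *)
pose ch F h := xget (point : cantor_space) [set a | good F h a].
pose w := Fix wf_lt (fun=> cantor_space)
  (fun i rec => ch [set a | exists j (ji : lt j i), rec j ji = a] (f i)).
have wE i : w i = ch (w @` [set j | lt j i]) (f i).
  rewrite /w Fix_eq => [|x u v uv]; last first.
    congr (ch _ _); apply/seteqP.
    by split=> a [j [ji <-]]; exists j, ji; rewrite uv.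
  congr (ch _ _); apply/seteqP; split=> [a [j [ji <-]]|a [j ji <-]].
    by exists j.
  by exists j, ji.
have wP i : good (w @` [set j | lt j i]) (f i) (w i).
  elim: (wf_lt i) => {}i _ IHi; rewrite wE; apply: (@xgetPex _ point).
  have [D /finite_seqP[s ->] sS|a Infa aP] :=
      @small_pseudointersection _ [set j | lt j i] w pb (smseg i).
    (* Among finitely many predecessors, the one with the largest index is almost contained in all
       the others, so the intersection is infinite. *)
    have [->|[j ji jP]] : s = [::] \/ exists2 j, lt j i &
        \forall n \near \oo, w j n -> all (fun x => w x n) s.
      elim: s sS => [|x s IHs] sS; [by left|right].
      have xi : lt x i by apply: sS; rewrite /= mem_head.
      have [|->|[j ji jP]] := IHs.
      - by move=> y ys; apply: sS; rewrite /= inE ys orbT.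
      - by exists x => //; apply: nearW => n /= ->.
      have /or3P[xj|/eqP xj|jx] := tot_lt x j.
      - have [_ _ /(_ (w x)) wjx] := IHi j ji; exists j => //.
        have /almost_subP jx : almost_sub (w j) (w x) by apply: wjx; exists x.
        by apply: filterS2 jP jx => n jP jx wj /=; rewrite jx ?jP.
      - by exists j => //; apply: filterS jP => n jP wj /=; rewrite xj wj jP.
      - have [_ _ /(_ (w j)) wxj] := IHi x xi; exists x => //.
        have /almost_subP xj : almost_sub (w x) (w j) by apply: wxj; exists j.
        by apply: filterS2 jP xj => n jP xj wx /=; rewrite wx jP ?xj.
      by apply: (sub_infinite_set _ infinite_nat) => n.
    have [Infj _ _] := IHi j ji.
    apply: sub_infinite_set (near_infinite Infj jP) => n [wj /(_ wj) /allP wn] x.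
    exact: wn.
  have hh : {homo enum_of a \o f i : m n / (m < n)%N}.
    by move=> m n mn /=; do 2!apply: enum_of_homo => //.
  (* Keeping only the elements of [a] numbered by the values of [f i] makes the one at position [n]
     at least [f i n]. *)
  exists (range_set (enum_of a \o f i)); split.
  - exact: Inf_range_set.
  - move=> n; rewrite enum_of_range_set//=.
    by apply: homo_ltn_geq_id; exact: enum_of_homo.
  - move=> _ [j ji <-]; apply: almost_sub_trans (aP _ ji).
    by apply/almost_subP/nearW => k /asboolP[n _ <-]; exact: enum_of_in.
exists lt, w; split=> //.
- by move=> i; have [] := wP i.
- by move=> i j ij; have [_ _] := wP j; apply; exists i.
- move=> g; have [a ba ga] := cardinal_b_unbounded g.
  pose i : cardinal_b := SigSub (mem_set ba); exists i.
  apply: sub_infinite_set ga => n /= gn; have [_ + _] := wP i.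
  by move=> /(_ n); exact: leq_trans.
Qed.

(* The set [v] is spread over the dyadic blocks [2^n, 2^(n+1)): the point [2^n]
   records whether [n] belongs to [v], and the rest of the block copies [y]. *)
Definition blow_up (v y : cantor_space) : cantor_space := fun n =>
  v (trunc_log 2 n) && ((n == 2 ^ trunc_log 2 n)%N || y n).

Lemma blow_up_expn v y n : blow_up v y (2 ^ n)%N = v n.
Proof. by rewrite /blow_up trunc_expnK// eqxx andbT. Qed.

Lemma Inf_blow_up v y : Inf v -> Inf (blow_up v y).
Proof.
move=> /infinite_natP Infv; apply/infinite_natP => N.
have [n Nn vn] := Infv N; exists (2 ^ n)%N; last by rewrite /supp /= blow_up_expn.
by apply: leq_trans Nn _; exact/ltnW/ltn_expl.
Qed.

(** This places the sum of [y] and its blow-up in the set of [null_gaps]: on a block selected by [v]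
    the two agree off the first point. *)
Lemma blow_up_symdiff_gap (v y : cantor_space) : Inf v ->
  forall k, exists2 n, (k <= n)%N & forall i, (2 ^ n < i < 2 ^ n.+1)%N ->
    ~~ symdiff (blow_up v y) y i.
Proof.
move=> /infinite_natP Infv k; have [n kn vn] := Infv k; exists n => // i.
move=> /andP[ni iN]; have logi : trunc_log 2 i = n.
  by apply: trunc_log_eq; rewrite // (ltnW ni).
by rewrite /symdiff /blow_up logi (vn : v n) gtn_eqF//= addbb.
Qed.

Section unbounded_tower_theory.
Variables (I : eqType) (lt : rel I) (w : I -> cantor_space).
Hypothesis tw : unbounded_tower lt w.

Definition tower_le (i j : I) : bool := (i == j) || lt i j.

Lemma tower_leNgt i j : tower_le i j = ~~ lt j i.
Proof.
have irr k : ~~ lt k k.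
  apply/negP => kk; elim: (tower_wf tw k) kk => m _ IHm mm; exact: (IHm m mm).
apply/idP/idP => [/orP[/eqP ->//|ij]|].
  by apply: contra (irr i) => ji; exact: (tower_trans tw ij ji).
by have /or3P[ij|ij|->//] := tower_total tw i j; rewrite /tower_le ij ?orbT.
Qed.

Lemma tower_le_trans i j k : tower_le i j -> tower_le j k -> tower_le i k.
Proof.
move=> /orP[/eqP ->//|ij] /orP[/eqP <-|jk]; rewrite /tower_le ?ij ?orbT//.
by rewrite (tower_trans tw ij jk) orbT.
Qed.

Lemma tower_le_almost_sub i j : tower_le i j -> almost_sub (w j) (w i).
Proof.
by move=> /orP[/eqP ->|]; [exact: almost_sub_refl|exact: tower_decr].
Qed.

Lemma tower_not_small : ~ small [set: I].
Proof.
move=> smI; have [g gP] := small_dominated (enum_of \o w) smI.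
have [i] := tower_unbounded tw g; apply; apply/finite_natP.
by apply: filterS (gP i Logic.I) => n le; apply/negP; rewrite -leqNgt.
Qed.

Lemma tower_min (A : set I) : A !=set0 ->
  exists2 i, A i & forall j, A j -> tower_le i j.
Proof.
move=> [i0 Ai0]; apply: contrapT => nmin.
elim: (tower_wf tw i0) Ai0 => i _ IHi Ai; apply: nmin; exists i => // j Aj.
by rewrite tower_leNgt; apply/negP => /IHi; exact.
Qed.

(** An unbounded sequence would make [I] a countable union of small segments, against
    [tower_not_small]; so upper bounds exist, and the least one serves. *)
Lemma tower_sup (a : nat -> I) : exists2 i, (forall k, tower_le (a k) i) &
  forall j, lt j i -> exists k, lt j (a k).
Proof.
have [i ai imin] : exists2 i, (forall k, tower_le (a k) i) &
    forall j, (forall k, tower_le (a k) j) -> tower_le i j.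
  apply: tower_min; apply: contrapT => nub; apply: tower_not_small.
  apply: (@small_le _ _ _ (\bigcup_k [set j | lt j (a k)])).
    apply: subset_card_le => j _; apply: contrapT => nj; apply: nub.
    exists j => k; rewrite tower_leNgt; apply/negP => jk.
    by apply: nj; exists k.
  by apply: small_bigcup => k; exact: (tower_small tw).
exists i => // j ji; apply: contrapT => nk.
have : tower_le i j.
  by apply: imin => k; rewrite tower_leNgt; apply/negP => jk; apply: nk; exists k.
by rewrite tower_leNgt ji.
Qed.

(* [h k] bounds the element of [w i] after [k], so [w i] is dominated by the
   iterates of a function growing faster than [k |-> h (2 ^ k.+1)]. *)
Lemma tower_misses (h : nat -> nat) : exists i, forall k0, exists2 k,
  (k0 <= k)%N & forall n, (k <= n < h k)%N -> ~~ w i (trunc_log 2 n).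
Proof.
(* The shift to [k.+1] allows for the search for the next element of [w i], which starts one past
   the current one. *)
pose H k := majorant (fun k => h (2 ^ k)%N) k.+1.
have H_homo : {homo H : m n / (m < n)%N} by move=> m n mn; exact: majorant_homo.
have H_le : {homo H : m n / (m <= n)%N}.
  by move=> m n; rewrite leq_eqVlt => /predU1P[->//|/H_homo/ltnW].
have H_iter n : {homo iter n H : k l / (k <= l)%N}.
  by elim: n => // n IHn k l /IHn /H_le.
have H_ge k n : (k <= iter n H k)%N.
  by elim: n => // n /leq_trans; apply; exact: homo_ltn_geq_id.
(* The diagonal [iter n H n] absorbs the starting value [e k0], which is not known before [i] is. *)
have [i wi] := tower_unbounded tw (fun n => iter n H n).
exists i; apply: contrapT => /existsNP[k0 k0P]; apply: wi; apply/finite_natP.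
(* If a block of [w i] meets the interval from [2 ^ k] at a point, the logarithm of that point is
   the required element: at least [k], and below the right end. *)
have next k : (k0 <= k)%N -> exists2 n, (k <= n < h (2 ^ k)%N)%N & w i n.
  move=> k0k; apply: contrapT => nn; apply: k0P; exists (2 ^ k)%N.
    by apply: leq_trans k0k _; exact/ltnW/ltn_expl.
  move=> n /andP[kn nh]; apply/negP => wn; apply: nn; exists (trunc_log 2 n) => //.
  have n0 : (0 < n)%N by apply: leq_trans kn; rewrite expn_gt0.
  rewrite trunc_log_max//=; apply: leq_ltn_trans nh.
  apply: leq_trans (trunc_logP (isT : (1 < 2)%N) n0).
  exact/ltnW/ltn_expl.
have [e_homo er] := enum_ofP (tower_Inf tw i); set e := enum_of (w i) in e_homo er *.
have e_le : {mono e : m n / (m <= n)%N} by exact: leq_mono.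
have e_lt m n : (e m < e n)%N -> (m < n)%N by rewrite !ltnNge e_le.
have e_iter n : (k0 <= n)%N -> (e n <= iter n H (e k0))%N.
  elim: n => [|n IHn]; first by rewrite leqn0 => /eqP ->.
  rewrite leq_eqVlt => /predU1P[->//|]; rewrite ltnS => k0n.
  have [|m /andP[em mh] wm] := next (e n).+1.
    by apply: leq_trans k0n _; exact/leqW/homo_ltn_geq_id.
  have [l _ el] : range e m by rewrite er.
  apply: leq_trans (H_le _ _ (IHn k0n)).
  apply: leq_trans (ltnW (majorant_ge _ _)); apply: leq_trans (ltnW mh).
  by rewrite -el e_le; apply: e_lt; rewrite el.
exists (maxn k0 (e k0)) => // n /=; rewrite geq_max => /andP[k0n en].
by apply/negP; rewrite -leqNgt; apply: leq_trans (e_iter _ k0n) _; exact: H_iter.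
Qed.

Lemma almost_sub_trunc_log a b : almost_sub a b ->
  \forall n \near \oo, a (trunc_log 2 n) -> b (trunc_log 2 n).
Proof.
move=> /almost_subP[N _ NP]; exists (2 ^ N)%N => // n /= Nn.
by apply: NP => /=; rewrite trunc_log_max.
Qed.

(** From some point on, the dyadic blocks of [w j] lie within those of [w i], so late intervals
    missed by the latter are missed by the former. *)
Lemma tower_misses_le h i j : tower_le i j ->
  (forall k0, exists2 k, (k0 <= k)%N &
    forall n, (k <= n < h k)%N -> ~~ w i (trunc_log 2 n)) ->
  forall k0, exists2 k, (k0 <= k)%N &
    forall n, (k <= n < h k)%N -> ~~ w j (trunc_log 2 n).
Proof.
move=> /tower_le_almost_sub /almost_sub_trunc_log[N _ NP] wi k0.
have [k] := wi (maxn k0 N); rewrite geq_max => /andP[k0k Nk] kP.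
exists k => // n /[dup] /kP + /andP[kn _]; apply: contra; apply: NP.
exact: leq_trans kn.
Qed.

Variable y : I -> cantor_space.

Let x i := blow_up (w i) (y i).

(** Reading [x i] at the powers of two recovers [w i], so a small range would give one function
    dominating the whole tower. *)
Lemma range_blow_up_not_small : ~ small (range x).
Proof.
move=> smx; pose r (z : cantor_space) : cantor_space := fun n => z (2 ^ n)%N.
have rx i : r (x i) = w i by apply/funext => n; rewrite /r /x blow_up_expn.
have [g gP] := small_dominated (enum_of \o r) smx.
have [i] := tower_unbounded tw g; apply; apply/finite_natP.
apply: filterS (gP (x i) (imageT x i)) => n /=; rewrite rx => le.
by apply/negP; rewrite -leqNgt.
Qed.

Lemma blow_up_generalized_tower : (cardinal_p #= cardinal_b)%card ->
  ([set: I] #<= cardinal_b)%card -> p_generalized_tower (range x).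
Proof.
move=> pb Ib; split.
- by move=> _ [i _ <-]; exact/Inf_blow_up/(tower_Inf tw).
- by rewrite (card_le_eql pb); apply: contrapT; exact: range_blow_up_not_small.
(* Since [k <= enum_of a k], a missed interval from [k] to [enum_of a k.+1] contains the whole
   interval of [a] with index [k]. *)
move=> a Infa; have [i iP] := tower_misses (fun k => enum_of a k.+1).
exists (fun n => `[< forall m, (enum_of a n <= m < enum_of a n.+1)%N ->
  ~~ w i (trunc_log 2 m) >]), (x @` [set j | lt j i]); split.
- apply/infinite_natP => N; have [k Nk kP] := iP N; exists k => //.
  apply/asboolP => m /andP[km mk]; apply: kP; rewrite mk andbT.
  by apply: leq_trans km; apply: homo_ltn_geq_id; exact: enum_of_homo.
- by move=> _ [j _ <-]; exists j.
- split.
    rewrite (card_le_eqr pb); apply: card_le_trans (card_image_le _ _) _.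
    by apply: card_le_trans Ib; exact: subset_card_le.
  rewrite (card_le_eql pb); apply: small_le (card_image_le _ _) _.
  exact: (tower_small tw).
- move=> _ [[j _ <-] nS]; have ij : tower_le i j.
    by rewrite tower_leNgt; apply/negP => ji; apply: nS; exists j.
  apply/finite_natP.
  apply: filterS (almost_sub_trunc_log (tower_le_almost_sub ij)) => m wji.
  by move=> [/andP[/wji wi _] [n /asboolP nP /= /nP]]; rewrite wi.
Qed.

End unbounded_tower_theory.

(** * The property gamma *)

(** Adding to [D] a point outside each of the first [N] sets forces the index of a set covering it
    to be at least [N]. *)
Lemma omega_cover_infinite (Y : set cantor_space) (u : nat -> set cantor_space) :
  (forall n, exists2 x, Y x & ~ u n x) ->
  (forall D, finite_set D -> D `<=` Y -> exists n, D `<=` u n) ->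
  forall D, finite_set D -> D `<=` Y -> infinite_set [set n | D `<=` u n].
Proof.
move=> u_proper uD D finD DY.
have /choice[c cP] n : exists c, Y c /\ ~ u n c.
  by have [c] := u_proper n; exists c.
apply/infinite_natP => N.
have [|z|n nP] := uD (D `|` c @` `I_N).
- by rewrite finite_setU; split=> //; exact/finite_image/finite_II.
- by move=> [/DY//|[i _ <-]]; have [] := cP i.
exists n => [|z Dz]; last by apply: nP; left.
rewrite leqNgt; apply/negP => nN; have [_] := cP n; apply.
by apply: nP; right; exists n.
Qed.

Lemma countable_Fin : countable Fin.
Proof.
pose r (s : seq bool) : cantor_space := nth false s.
apply: (@sub_countable _ _ _ (r @` setT)).
  apply: subset_card_le => z /finite_natP[N _ NP]; exists (mkseq z N) => //.
  apply/funext => n; rewrite /r; have [nN|Nn] := ltnP n N.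
    by rewrite nth_mkseq.
  by rewrite nth_default ?size_mkseq//; apply/esym/negbTE/negP; exact: NP.
by apply: card_le_trans (card_image_le _ _) _; exact: countableP.
Qed.

(* Galvin and Miller: only the finitely many traces on [0, k) matter, and each
   of them, padded by zeros, belongs to [Fin]. *)
Lemma Fin_gap (Y : set cantor_space) (u : nat -> set cantor_space) (a : cantor_space) :
  Fin `<=` Y ->
  (forall n z, Y z -> u n z ->
    exists N, forall z', Y z' -> (forall i, (i < N)%N -> z i = z' i) -> u n z') ->
  Inf a -> (forall z, Fin z -> \forall n \near \oo, a n -> u n z) ->
  forall k, exists n, [/\ (k <= n)%N, a n & exists m, forall z, Y z ->
    (forall i, (k <= i < m)%N -> ~~ z i) -> u n z].
Proof.
move=> FinY uloc Infa ua k.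
have Fin_pad (t : k.-tuple bool) : Fin (pad t).
  apply/finite_natP; exists k => // n /= kn.
  by rewrite /supp/= /pad nth_default// size_tuple.
have : \forall n \near \oo, forall t : k.-tuple bool, a n -> u n (pad t).
  by apply: filter_forall => t; exact: ua.
move=> /(near_infinite Infa)/infinite_natP/(_ k)[n kn [an nP]].
have /choice[N NP] (t : k.-tuple bool) := uloc n _ (FinY _ (Fin_pad t)) (nP t an).
exists n; split=> //; exists (\max_t N t) => z Yz zk.
apply: (NP [tuple z i | i < k]) => // i; have [ik|ki] := ltnP i k => iN.
  have := tnth_nth false [tuple z i | i < k] (Ordinal ik).
  by rewrite tnth_mktuple /pad /= => <-.
rewrite /pad nth_default ?size_tuple//; apply/esym/negbTE/zk; rewrite ki /=.
by apply: leq_trans iN _; exact: leq_bigmax.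
Qed.

Section gamma_selection.
Variables (I : eqType) (lt : rel I) (w : I -> cantor_space).
Hypothesis pb : (cardinal_p #= cardinal_b)%card.
Hypothesis tw : unbounded_tower lt w.
Variable y : I -> cantor_space.

Let x i := blow_up (w i) (y i).
Let Y := range x `|` Fin.

Variable u : nat -> set cantor_space.
Hypothesis u_local : forall n z, Y z -> u n z ->
  exists N, forall z', Y z' -> (forall i, (i < N)%N -> z i = z' i) -> u n z'.
Hypothesis u_proper : forall n, exists2 z, Y z & ~ u n z.
Hypothesis u_omega : forall D, finite_set D -> D `<=` Y -> exists n, D `<=` u n.

Lemma small_initial_Fin i : small (x @` [set j | lt j i] `|` Fin).
Proof.
apply: small_setU (countable_small countable_Fin).
exact: small_le (card_image_le _ _) (tower_small tw i).
Qed.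

(** By p = b, the index sets of the [u n] containing [z], for the fewer than b points [z] in
    question, have a pseudointersection. [Fin_gap] picks from it an index [n k] with gap from [k] to
    [h k], and [tower_misses] supplies a tower member missing infinitely many of these gaps; the
    larger of its index and [i] is returned. *)
Lemma gamma_step i : exists (n h : nat -> nat) (j : I), [/\
  forall z, (x @` [set j | lt j i] `|` Fin) z -> \forall k \near \oo, u (n k) z,
  forall k z, Y z -> (forall m, (k <= m < h k)%N -> ~~ z m) -> u (n k) z &
  tower_le lt i j /\ forall k0, exists2 k, (k0 <= k)%N &
    forall m, (k <= m < h k)%N -> ~~ w j (trunc_log 2 m)].
Proof.
set Z := _ `|` Fin.
have ZY : Z `<=` Y by move=> z [[j _ <-]|Fz]; [left; exists j|right].
have [|a Infa aP] := @small_pseudointersection _ Z (fun z n => `[< u n z >]) pb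
    (@small_initial_Fin i).
  move=> D finD DZ; apply: sub_infinite_set (omega_cover_infinite u_proper
    u_omega finD (subset_trans DZ ZY)) => n /= Dn z /Dn; exact: asboolT.
have az z : Z z -> \forall n \near \oo, a n -> u n z.
  by move=> /aP /almost_subP; apply: filterS => n + an => /(_ an) /asboolP.
have /choice[n nP] := Fin_gap (@subsetUr _ _ _) u_local Infa
  (fun z Fz => az z (or_intror Fz)).
have /choice[h hP] k : exists m, forall z, Y z ->
    (forall i, (k <= i < m)%N -> ~~ z i) -> u (n k) z by have [] := nP k.
have [j jP] := tower_misses tw h.
have [l [il jl]] : exists l, tower_le lt i l /\ tower_le lt j l.
  have [ij|] := boolP (tower_le lt i j).
    by exists j; rewrite ij /tower_le eqxx.
  by rewrite (tower_leNgt tw) negbK => ji; exists i; rewrite /tower_le eqxx ji orbT.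
exists n, h, l; split=> // [z /az[N _ NP]|].
  exists N => // k /= Nk; have [kn an _] := nP k.
  by apply: NP => //=; exact: leq_trans kn.
by split=> //; exact: (tower_misses_le tw jl).
Qed.

Lemma gamma_selection :
  exists v : nat -> nat, forall z, Y z -> \forall k \near \oo, u (v k) z.
Proof.
have /choice[F FP] i : exists q : (nat -> nat) * (nat -> nat) * I, [/\
    forall z, (x @` [set j | lt j i] `|` Fin) z ->
      \forall k \near \oo, u (q.1.1 k) z,
    forall k z, Y z -> (forall m, (k <= m < q.1.2 k)%N -> ~~ z m) -> u (q.1.1 k) z &
    tower_le lt i q.2 /\ forall k0, exists2 k, (k0 <= k)%N &
      forall m, (k <= m < q.1.2 k)%N -> ~~ w q.2 (trunc_log 2 m)].
  by have [n [h [j jP]]] := gamma_step i; exists (n, h, j).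
have [i0 _] := tower_unbounded tw id.
pose a k := iter k (fun i => (F i).2) i0.
pose n k := (F (a k)).1.1; pose h k := (F (a k)).1.2.
have a_le k l : (k <= l)%N -> tower_le lt (a k) (a l).
  move=> /subnKC <-; elim: (l - k)%N => [|m IHm]; first by rewrite addn0 /tower_le eqxx.
  rewrite addnS; apply: (tower_le_trans tw IHm).
  by have [_ _ []] := FP (a (k + m)%N).
have [s a_s s_lub] := tower_sup tw a.
(* [phi k] is a place from which sequence [k] contains [z]. For [z = x j] this is ensured once [j]
   is below [a k], hence for almost all [k], as [j] is below the supremum. *)
have /choice[phi phiP] z : exists phi : nat -> nat,
    (x @` [set j | lt j s] `|` Fin) z ->
    \forall k \near \oo, forall l, (phi k <= l)%N -> u (n k l) z.
  have [Zz|] := pselect ((x @` [set j | lt j s] `|` Fin) z); last by exists id.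
  have [k0 k0P] : exists k0, forall k, (k0 <= k)%N ->
      (x @` [set j | lt j (a k)] `|` Fin) z.
    case: Zz => [[j /s_lub[k0 jk0] <-]|]; last by exists 0%N => k _; right.
    exists k0 => k /a_le kk0; left; exists j => //=.
    by case/orP: kk0 => [/eqP <-//|]; exact: tower_trans tw _ _ _ _.
  have /choice[phi phiP] k : exists m, (k0 <= k)%N ->
      forall l, (m <= l)%N -> u (n k l) z.
    have [k0k|_] := leqP k0 k; last by exists 0%N.
    by have [/(_ _ (k0P _ k0k))[m _ mP] _ _] := FP (a k); exists m.
  by exists phi => _; exists k0 => // k /phiP.
have [g gP] := small_dominated phi (@small_initial_Fin s).
(* [K k] starts a gap of sequence [k] missed by [w s], which exists because [s] is above [a k.+1].
   The bound [g k] serves the points before [s]; the bound [k] moves the gaps to infinity. *)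
have /choice[K KP] k : exists l, [/\ (k <= l)%N, (g k <= l)%N &
    forall m, (l <= m < h k l)%N -> ~~ w s (trunc_log 2 m)].
  have [_ _ [_ ms]] := FP (a k).
  have [l] := tower_misses_le tw (a_s k.+1) ms (maxn k (g k)).
  by rewrite geq_max => /andP[kl gl] lP; exists l.
exists (fun k => n k (K k)) => z Yz.
have [Zz|nZ] := pselect ((x @` [set j | lt j s] `|` Fin) z).
  apply: filterS2 (phiP z Zz) (gP z Zz) => k kP le; apply: kP.
  by have [_ gK _] := KP k; exact: leq_trans gK.
case: Yz (Yz) => [[j _ zE]|Fz]; last by case: nZ; right.
have sj : tower_le lt s j.
  by rewrite (tower_leNgt tw); apply/negP => js; apply: nZ; left; exists j.
(* Beyond [N] the blocks of [w j] lie within those of [w s], so [x j] vanishes on the chosen gap. *)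
have [N _ NP] := almost_sub_trunc_log (tower_le_almost_sub tw sj).
move=> Yz; exists N => // k /= Nk; have [_ + _] := FP (a k); apply=> // m mK.
have [kK _ Ks] := KP k; rewrite -zE; apply/negP => /andP[wj _].
have /negP := Ks m mK; apply; apply: NP wj => /=.
by case/andP: mK => Km _; exact: leq_trans (leq_trans kK Km).
Qed.

End gamma_selection.

(** * Open covers of subspaces of the Cantor cube *)

Lemma cylinder_basis (z : cantor_space) (V : set cantor_space) : open V -> V z ->
  exists N, forall z', (forall i, (i < N)%N -> z i = z' i) -> V z'.
Proof.
(* The open sets [W n] increase and cover everything but [z], so by compactness one of them contains
   the complement of [V]. *)
move=> oV Vz; pose W n := [set z' : cantor_space | exists2 i, (i < n)%N & z i <> z' i].
have oW n : open (W n).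
  apply: (@depends_on_open n) => a b ab [i iN zi]; exists i => //.
  by rewrite -ab.
have cV : compact (~` V).
  by apply: (subclosed_compact _ cantor_space_compact) => //; rewrite closedC.
move: cV; rewrite compact_cover => /(_ nat setT W (fun n _ => oW n)) [|D _ DV].
  move=> z' nVz'; have [i zi] : exists i, z i <> z' i.
    apply/existsNP => zz'; apply: nVz'.
    by rewrite (_ : z' = z)//; apply/funext => i; rewrite zz'.
  by exists i.+1 => //; exists i.
exists (\max_(n : D) val n) => z' zz'; apply: contrapT => /DV[n Dn [i iN]].
apply; apply: zz'; apply: leq_trans iN _.
by apply: (@leq_bigmax _ (fun n : D => val n) (FSetSub Dn)).
Qed.

Lemma set_type_local (Y : set cantor_space) (O : set Y) (t : Y) :
  open O -> O t -> exists N, forall t' : Y,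
    (forall i, (i < N)%N -> \val t i = \val t' i) -> O t'.
Proof.
move=> [V oV <-] Vt; have [N NP] := cylinder_basis oV Vt.
by exists N => t' /NP.
Qed.

(** Reduces the property gamma to omega-covers listed as sequences, with openness expressed by
    cylinders; a countable base makes this enough. *)
Lemma set_property_gamma_seq (Y : set cantor_space) :
  (forall u : nat -> set cantor_space,
    (forall n z, Y z -> u n z -> exists N, forall z', Y z' ->
      (forall i, (i < N)%N -> z i = z' i) -> u n z') ->
    (forall n, exists2 z, Y z & ~ u n z) ->
    (forall D, finite_set D -> D `<=` Y -> exists n, D `<=` u n) ->
    exists v : nat -> nat, forall z, Y z -> \forall k \near \oo, u (v k) z) ->
  set_property_gamma Y.
Proof.
move=> sel U oU [[Uproper Ucover] Uomega].
have [u0 Uu0 _] := Uomega _ (finite_set0 _).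
(* Finite unions of cylinders, coded by lists of their stems: choosing one
   member of [U] above each of them gives a countable omega-subcover. *)
pose C (c : seq (seq bool)) (z : cantor_space) :=
  has (fun s => mkseq z (size s) == s) c.
have /choice[G GP] c : exists u : set Y, U u /\
    ((exists2 u', U u' & forall t : Y, C c (\val t) -> u' t) ->
     forall t : Y, C c (\val t) -> u t).
  have [[u Uu uP]|] := pselect (exists2 u', U u' & forall t : Y, C c (\val t) -> u' t).
    by exists u.
  by exists u0.
(* Numbers that code no list are read as the empty list, whose choice still lies in [U]. *)
pose g (n : nat) := G (odflt [::] (choice.unpickle n)).
have Ug n : U (g n) by have [] := GP (odflt [::] (choice.unpickle n)).
have [|n|D finD DY|v vP] := sel (fun n => [set \val t | t in g n]).
- move=> n _ _ [t gt <-]; have [N NP] := set_type_local (oU _ (Ug n)) gt.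
  exists N => z' Yz' tz'; exists (SigSub (mem_set Yz')) => //; exact: NP.
- have : exists t, ~ g n t.
    apply/existsNP => gT; apply: (Uproper _ (Ug n)).
    by apply/seteqP; split=> // t _; exact: gT.
  move=> [t ngt]; exists (\val t); first exact: set_mem (valP t).
  by move=> [t' gt' /val_inj tt']; apply: ngt; rewrite -tt'.
- have finD' : finite_set [set t : Y | D (\val t)].
    by apply: finite_preimage finD => a b _ _ /val_inj.
  have [u Uu Du] := Uomega _ finD'.
  have /choice[N NP] z : exists N, D z ->
      forall t' : Y, (forall i, (i < N)%N -> z i = \val t' i) -> u t'.
    have [Dz|nDz] := pselect (D z); last by exists 0%N.
    pose t : Y := SigSub (mem_set (DY _ Dz)).
    have [N NP] := set_type_local (oU _ Uu) (Du t Dz).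
    by exists N => _.
  have [s Ds] := (finite_seqP _).1 finD.
  (* The union of these cylinders lies between [D] and [u], so [u] witnesses that the member chosen
     for [c] contains it. *)
  pose c := [seq mkseq z (N z) | z <- s].
  exists (choice.pickle c) => z Dz; pose t : Y := SigSub (mem_set (DY _ Dz)).
  exists t => //; rewrite /g choice.pickleK /=.
  have [_ /(_ _ t) Gc] := GP c; apply: Gc.
    exists u => // t' /hasP[_ /mapP[z' sz' ->]]; rewrite size_mkseq => /eqP tz'.
    have Dz' : D z' by rewrite Ds.
    apply: (NP z') => // i iN.
    by have := congr1 (nth false ^~ i) tz'; rewrite !nth_mkseq.
  apply/hasP; exists (mkseq z (N z)); last by rewrite size_mkseq.
  by apply: map_f; move: (Dz); rewrite {1}Ds.
have gP (t : Y) : \forall k \near \oo, g (v k) t.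
  by apply: filterS (vP _ (set_mem (valP t))) => k [t' gt' /val_inj <-].
exists (range (g \o v)); first by move=> _ [k _ <-]; exact: Ug.
split.
- split=> [_ [k _ <-]|]; first exact: Uproper (Ug _).
  apply/seteqP; split=> // t _; have [k _ /(_ k (leqnn k)) gk] := gP t.
  by exists (g (v k)) => //; exists k.
(* A member repeated infinitely often would contain every point, yet members are proper; so all
   fibres are finite and the range is infinite. *)
- move=> finV; have : finite_set [set: nat]; last exact: infinite_nat.
  rewrite (_ : setT = \bigcup_(V in range (g \o v)) [set k | g (v k) = V]).
    apply: bigcup_finite => // _ [k _ <-]; apply: contrapT => infk.
    apply: (Uproper _ (Ug (v k))); apply/seteqP; split=> // t _.
    have [l [/= <- //]] := infinite_setN0 (near_infinite infk (gP t)).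
  by apply/seteqP; split=> // k _; exists (g (v k)) => //; exists k.
- move=> t; apply: (@sub_finite_set _ _ ((g \o v) @` [set k | ~ g (v k) t])).
    by move=> _ [[k _ <-] ngt]; exists k.
  apply: finite_image; apply/finite_natP; apply: filterS (gP t) => k /=.
  by move=> gt; apply.
Qed.

(** * A null set *)

Local Open Scope ring_scope.

(** A string in the event is determined by its first [2 ^ n + 1] bits out of [2 ^ n.+1], and
    [n < 2 ^ n]. *)
Lemma proportion_gap_le (R : realType) n :
  proportion R (2 ^ n.+1) [set z | forall i, (2 ^ n < i < 2 ^ n.+1)%N -> ~~ z i]
    <= 2 ^- n.
Proof.
rewrite /proportion; set A := [set t : _.-tuple bool | _]%SET.
pose c (t : (2 ^ n.+1).-tuple bool) := [tuple pad t i | i < (2 ^ n).+1].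
have c_inj : {in A &, injective c}.
  move=> s t; rewrite !inE => sP tP cst.
  apply: eq_from_tnth => i; rewrite !(tnth_nth false).
  have [ni|ni] := ltnP (2 ^ n) i.
    have in_gap : (2 ^ n < i < 2 ^ n.+1)%N by rewrite ni ltn_ord.
    rewrite (negbTE (sP _ in_gap) : nth _ _ _ = _).
    by rewrite (negbTE (tP _ in_gap) : nth _ _ _ = _).
  rewrite -ltnS in ni.
  by have := congr1 (fun v => tnth v (Ordinal ni)) cst; rewrite !tnth_mktuple.
have cardA : (#|A| <= 2 ^ (2 ^ n).+1)%N.
  rewrite -(card_in_imset c_inj); apply: leq_trans (max_card _) _.
  by rewrite card_tuple card_bool.
rewrite ler_pdivrMr ?exprn_gt0// mulrC -[leRHS]/(2 ^+ (2 ^ n.+1) / 2 ^+ n).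
rewrite ler_pdivlMr ?exprn_gt0// -natrX -natrX -natrM ler_nat.
apply: leq_trans (leq_mul cardA (leqnn _)) _.
rewrite -expnD leq_exp2l// expnS mul2n -addnn addSn -addnS leq_add2l.
exact: ltn_expl.
Qed.

(** Borel-Cantelli: the set is the limit superior of events with summable measures. *)
Lemma null_gaps (R : realType) : null R [set z | forall k, exists2 n, (k <= n)%N &
  forall i, (2 ^ n < i < 2 ^ n.+1)%N -> ~~ z i].
Proof.
pose T := g_sigma_algebraType (@measurable coin_display coin_space).
pose E n : set cantor_space :=
  [set z | forall i, (2 ^ n < i < 2 ^ n.+1)%N -> ~~ z i].
have depE n : depends_on (2 ^ n.+1) (E n).
  by move=> a b ab Ea i /[dup] /Ea + /andP[_ ilt]; rewrite ab.
have mE n : measurable (E n : set T).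
  by apply: sub_gen_smallest; exists (2 ^ n.+1)%N; exact: depE.
have E0 : coin_measure R (lim_sup_set (E : (set T)^nat)) = 0%E.
  apply: lim_sup_set_cvg0 => //.
  have sum2 := @cvg_geometric_eseries_half R 2 0.
  apply: (@le_lt_trans _ _ (\sum_(n <oo) (2 / (2 ^ (n + 1))%:R)%:E)%E).
    apply: lee_nneseries => // n _; rewrite [leLHS](coin_measureE R (depE n)) lee_fin.
    rewrite addn1 natrX exprS invfM mulVKf// ?pnatr_eq0//.
    exact: proportion_gap_le.
  by have /cvg_lim -> := sum2; rewrite ?ltry.
exists (lim_sup_set (E : (set T)^nat)); split=> //.
  by apply: bigcap_measurable => // k _; exact: bigcup_measurable.
by move=> z zP k _; have [n kn nP] := zP k; exists n.
Qed.

Lemma not_null_setT (R : realType) : ~ null R setT.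
Proof.
move=> /(measure_negligible measurableT) T0.
have := coin_measure_cylinder R 0 point.
rewrite (_ : [set y | _] = setT); last by apply/seteqP; split.
by rewrite T0 expr0 invr1 => /eqP; rewrite eq_sym onee_eq0.
Qed.

Theorem theorem3p1 (R : realType) :
  (cardinal_p #= cardinal_b)%card ->
  (cardinal_b #= cardinal_nonN R)%card ->
  exists X : set cantor_space,
    [/\ p_generalized_tower X,
        ~ null_additive R X,
        nontrivial_gamma (X `|` Fin) &
        ~ null_additive R (X `|` Fin)].
Proof.
move=> pb bN; have [|nonnull _] := @min_cardP _ [set A | ~ null R A].
  by exists setT; exact: not_null_setT.
have [lt [w tw]] := exists_unbounded_tower pb.
have [y yP] : exists y : cardinal_b -> cantor_space, cardinal_nonN R `<=` range y.
  have := card_eq_trans (card_setT cardinal_b) bN.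
  by move=> /card_eqPle[_ /pcard_surjP[y ysurj]]; exists y.
set X := range (fun i => blow_up (w i) (y i)).
(* Stated for supersets to serve both [X] and its union with [Fin]. Adding [x_i] to the element
   [x_i + y_i] of the null set returns [y_i]. *)
have Xna Y : X `<=` Y -> ~ null_additive R Y.
  move=> XY /(_ _ (null_gaps R)) YN; apply: nonnull; apply: negligibleS YN.
  move=> _ /yP[i _ <-]; exists (blow_up (w i) (y i)); first by apply: XY; exists i.
  exists (symdiff (blow_up (w i) (y i)) (y i)).
    exact/blow_up_symdiff_gap/(tower_Inf tw).
  by apply/funext => n; rewrite /symdiff addbA addbb.
have Xtower : p_generalized_tower X.
  apply: (blow_up_generalized_tower tw) => //.
  by have /card_eqPle[] := card_setT cardinal_b.
exists X; split=> //; [exact: Xna| |exact/Xna/subsetUl].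
split; last first.
  by have [_ pX _] := Xtower; apply: card_le_trans pX _; exact/subset_card_le/subsetUl.
apply: set_property_gamma_seq => u uloc uprop uom.
exact: (gamma_selection pb tw uloc uprop uom).
Qed.
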